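(* Let $X$ be a pointed metric space with at least two points and let $F$ be a Banach space. Then a linear functional $T$ on $\mathrm{Lip}_0(X,F)$ is in the dual of $(\mathrm{Lip}_0(X,F),\gamma\tau_\gamma)$ if and only if there exist sequences $\{\phi_n\}$ in $F'$ and $\{(x_n,y_n)\}$ in $\widetilde X$ such that $\sum_{n=1}^\infty\|\phi_n\|<\infty$ and $$T(f)=\sum_{n=1}^\infty\phi_n\left(\frac{f(x_n)-f(y_n)}{d(x_n,y_n)}\right)$$ for all $f\in\mathrm{Lip}_0(X,F)$.
   Context: $\mathbb{K}$ is $\mathbb{R}$ or $\mathbb{C}$. $(X,d)$ is a metric space with a distinguished base point $0$, and $\widetilde X=\{(x,y)\in X^2\colon x\ne y\}$. For a Banach space $F$ over $\mathbb{K}$ with dual $F'$, $\mathrm{Lip}_0(X,F)$ is the space of all Lipschitz maps $f\colon X\to F$ with $f(0)=0$. The topology $\gamma\tau_\gamma$ on $\mathrm{Lip}_0(X,F)$ is the locally convex topology generated by the seminorms $q(f)=\sup_{n\in\mathbb{N}}\alpha_n\frac{\|f(x_n)-f(y_n)\|}{d(x_n,y_n)}$, where $\{\alpha_n\}$ ranges over sequences in $\mathbb{R}^+$ tending to zero and $\{(x_n,y_n)\}$ over sequences in $\widetilde X$. The dual of $(\mathrm{Lip}_0(X,F),\gamma\tau_\gamma)$ is the space of all $\gamma\tau_\gamma$-continuous linear functionals. *)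

(* Defs.v *)
From HB Require Import structures.
From mathcomp Require Import all_boot all_order all_algebra.
From mathcomp Require Import complex.
From mathcomp Require Import all_classical all_reals all_analysis.

Set Implicit Arguments.
Unset Strict Implicit.
Unset Printing Implicit Defensive.

Import Order.TTheory GRing.Theory Num.Theory.
Import numFieldNormedType.Exports.

Local Open Scope classical_set_scope.
Local Open Scope ring_scope.
Local Open Scope complex_scope.

Variant scalar_kind := RealScalars | ComplexScalars.

Definition scalars (R : realType) (k : scalar_kind) : numFieldType :=
  match k with RealScalars => R | ComplexScalars => R[i] end.

Definition ofReal (R : realType) (k : scalar_kind) : R -> scalars R k :=
  match k return R -> scalars R k with
  | RealScalars => id
  | ComplexScalars => fun r => r%:C
  end.

Definition rePart (R : realType) (k : scalar_kind) : scalars R k -> R :=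
  match k return scalars R k -> R with
  | RealScalars => id
  | ComplexScalars => fun z => complex.Re z
  end.

(* The norm of a [normedModType K] takes its values in [K]: for [K = R[i]] it is
   a nonnegative complex number, which [rnorm] reads as a real number. *)
Definition rnorm (R : realType) (k : scalar_kind)
  (V : normedModType (scalars R k)) (v : V) : R := rePart `|v|.

Section scalar_theory.
Context (R : realType) (k : scalar_kind) (V : normedModType (scalars R k)).
Implicit Types (v w : V) (a : scalars R k).

Lemma normE_rnorm v : `|v| = ofReal k (rnorm v).
Proof.
rewrite /rnorm; have := normr_ge0 v; move: `|v|.
by case: k => //= -[x y] /=; rewrite lecE /= => /andP[/eqP -> _].
Qed.

Lemma rePart_le (x y : scalars R k) : x <= y -> rePart x <= rePart y.
Proof. by case: k x y => //= -[x x'] [y y']; rewrite lecE => /andP[]. Qed.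

Lemma rnorm0 : rnorm (0 : V) = 0.
Proof. by rewrite /rnorm normr0; case: k. Qed.

Lemma rnormD v w : rnorm (v + w) <= rnorm v + rnorm w.
Proof.
have -> : rnorm v + rnorm w = rePart (`|v| + `|w|).
  by rewrite /rnorm; move: `|v| `|w|; case: k => //= -[x x'] [y y'].
exact/rePart_le/ler_normD.
Qed.

Lemma rnormZ a v : rnorm (a *: v) = rePart `|a| * rnorm v.
Proof.
rewrite {1}/rnorm normrZ normE_rnorm.
by move: a (rnorm v); case: k => //= -[x y] r /=; rewrite !mulr0 subr0.
Qed.

Lemma rePart_norm_ge0 a : 0 <= rePart `|a|.
Proof. by have /rePart_le := normr_ge0 a; case: k a. Qed.

End scalar_theory.

Section Lip0.
Context (R : realType) (k : scalar_kind) (X : metricType R) (x0 : X)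
  (F : normedModType (scalars R k)).

Definition is_lipschitz (f : X -> F) : Prop :=
  exists L : R, forall x y : X, rnorm (f x - f y) <= L * mdist x y.

Definition lip0_pred : {pred X -> F} :=
  mem [set f : X -> F | is_lipschitz f /\ f x0 = 0].

Lemma lip0_submod_closed : submod_closed lip0_pred.
Proof.
split; first by rewrite inE; split=> //; exists 0 => x y; rewrite subrr rnorm0 mul0r.
move=> a f g; rewrite !inE => -[[L fL] f0] [[M gM] g0]; split; last first.
  by rewrite !fctE f0 g0 scaler0 addr0.
exists (rePart `|a| * L + M) => x y; rewrite !fctE.
rewrite opprD addrACA -scalerBr mulrDl -mulrA.
rewrite (le_trans (rnormD _ _))// lerD// rnormZ ler_wpM2l//.
exact: (rePart_norm_ge0 a).
Qed.

HB.instance Definition _ :=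
  GRing.isSubmodClosed.Build _ _ lip0_pred lip0_submod_closed.

Record Lip0 := MkLip0 { lip0_fun :> X -> F ; _ : lip0_fun \in lip0_pred }.

HB.instance Definition _ := [isSub for lip0_fun].
HB.instance Definition _ := [Choice of Lip0 by <:].
HB.instance Definition _ := [SubChoice_isSubLmodule of Lip0 by <:].

End Lip0.

(* The space [E] with the locally convex topology generated by the family [Q] of
   seminorms. *)
Definition seminorm_topology (R : realType) (K : numDomainType) (E : lmodType K)
  (Q : set (E -> R)) : Type := E.

Section seminorm_topology.
Context (R : realType) (K : numDomainType) (E : lmodType K) (Q : set (E -> R)).

(* The balls with arbitrary centres are a subbase, their finite intersections a
   base, of the topology. *)
Definition seminorm_balls : set_system E :=
  [set B | exists q c r, [/\ Q q, 0 < r & B = [set x | q (x - c) < r]]].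

HB.instance Definition _ := GRing.Lmodule.on (seminorm_topology Q).
HB.instance Definition _ :=
  isSubBaseTopological.Build (seminorm_topology Q) seminorm_balls id.

End seminorm_topology.

Section gamma_tau.
Context (R : realType) (k : scalar_kind) (X : metricType R) (x0 : X)
  (F : normedModType (scalars R k)).

(* The set is bounded (hence [sup] is the actual supremum) as soon as [alpha]
   tends to zero and [x n <> y n] for all [n], because [f] is Lipschitz. *)
Definition gamma_seminorm (alpha : nat -> R) (x y : nat -> X)
    (f : Lip0 x0 F) : R :=
  sup (range (fun n => alpha n * (rnorm (f (x n) - f (y n)) / mdist (x n) (y n)))).

Definition gamma_seminorms : set (Lip0 x0 F -> R) :=
  [set q | exists (alpha : nat -> R) (x y : nat -> X),
    [/\ forall n, 0 < alpha n, alpha @ \oo --> (0 : R),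
        forall n, x n <> y n & q = gamma_seminorm alpha x y]].

Definition Lip0_gamma_tau : Type := seminorm_topology gamma_seminorms.

HB.instance Definition _ := GRing.Lmodule.on Lip0_gamma_tau.
HB.instance Definition _ := Topological.on Lip0_gamma_tau.

End gamma_tau.

(* The operator norm; meaningful for continuous [phi], which is imposed separately
   wherever it is used. *)
Definition dual_norm (R : realType) (k : scalar_kind)
    (F : normedModType (scalars R k)) (phi : F -> scalars R k) : R :=
  sup [set rnorm (phi v) | v in [set v : F | rnorm v <= 1]].

(* Main.v *)
Require Import Defs.
From HB Require Import structures.
From mathcomp Require Import all_boot all_order all_algebra.
From mathcomp Require Import complex.
From mathcomp Require Import all_classical all_reals all_analysis.
From mathcomp Require Import ring lra.
Import Order.TTheory GRing.Theory Num.Theory.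
Import numFieldNormedType.Exports.
Local Open Scope classical_set_scope.
Local Open Scope ring_scope.

Set Implicit Arguments.
Unset Strict Implicit.
Unset Printing Implicit Defensive.

(** The seminorm of the topology attached to weights [alpha] and pairs
    [(x n, y n)] is the sup norm of the sequence

      [A f n = alpha n * (f (x n) - f (y n)) / d (x n, y n)],

    and [A f] tends to zero because [f] is Lipschitz and [alpha] tends to zero.
    So [A] is a linear map from the Lipschitz space to the space [c0 F] of null
    sequences of [F], and the seminorm is the pullback of the norm of [c0 F].
    Interleaving two sequences of weights and pairs dominates both seminorms by
    a third one ([gamma_seminorms_directed]), so a functional [T] is continuous
    iff it is bounded by a multiple of a single such seminorm
    ([continuous_seminormP]).

    If [|T f| <= C * |A f|], then the Hahn-Banach theorem
    ([scalars_hahn_banach]) factors [T] as [S \o A] with [S] bounded on [c0 F].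
    The dual of [c0 F] is the space of absolutely summable sequences in the dual
    of [F]: null sequences are limits of their truncations, whence [S] is the sum
    of its coordinates ([c0_dual_sum]), and testing [S] on finite sequences of
    suitably rotated vectors bounds the sum of their norms
    ([c0_dual_abs_sum]).  Absorbing the weights in the coordinates gives the
    functionals [phi n] ([dominated_series]).

    Conversely, a summable sequence of norms [a n = |phi n|] can be divided by
    some positive weights tending to zero and stay summable
    ([summable_weights]); with these weights, the series is dominated by a
    multiple of the corresponding seminorm ([summable_dominated]).

    The Hahn-Banach theorem is obtained from Zorn's lemma applied to sublinear
    functionals rather than to partial extensions: a minimal sublinear functional
    is linear, and the constraint to be met on a subspace is first built into the
    sublinear functional by an infimum ([cone_minorant]).  The complex case
    follows from the real one by [S x = v x - i * v (i * x)]. *)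

(** * The real Hahn-Banach theorem *)

Section HahnBanach.
Context (R : realType) (V : lmodType R).
Implicit Types (p q : V -> R) (x y : V).

Definition sublinear p :=
  (forall x y, p (x + y) <= p x + p y) /\
  (forall (t : R) x, 0 <= t -> p (t *: x) <= t * p x).

Lemma sublinear0 p : sublinear p -> p 0 = 0.
Proof.
move=> [pD pZ]; apply/eqP; rewrite eq_le; apply/andP; split.
  by have := pZ 0 0 (lexx 0); rewrite scale0r mul0r.
by have := pD 0 0; rewrite addr0 lerDl.
Qed.

Lemma sublinearN_ge p x : sublinear p -> - p (- x) <= p x.
Proof.
move=> sp; have [pD _] := sp.
by rewrite lerNl -subr_ge0 opprK addrC -(sublinear0 sp) -{1}(subrr x).
Qed.

Lemma le_inf_add (A B : set R) (r : R) : A !=set0 -> B !=set0 ->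
  (forall a b, A a -> B b -> r <= a + b) -> r <= inf A + inf B.
Proof.
move=> A0 B0 rAB; rewrite -lerBlDr; apply: lb_le_inf => // a Aa.
rewrite lerBlDr -lerBlDl; apply: lb_le_inf => // b Bb.
by rewrite lerBlDl rAB.
Qed.

(** Sublinearity survives an infimum as soon as the two sublinear inequalities
    can be met up to a change of index: [F] is jointly sublinear in the index
    and the vector.  This covers both the infimum of a chain of sublinear
    functionals and the infimum over a cone of translates. *)
Lemma inf_sublinear (I : Type) (D : set I) (F : I -> V -> R) :
  D !=set0 -> (forall x, has_lbound [set F i x | i in D]) ->
  (forall i j x y, D i -> D j ->
     exists2 k, D k & F k (x + y) <= F i x + F j y) ->
  (forall i t x, D i -> 0 <= t ->
     exists2 k, D k & F k (t *: x) <= t * F i x) ->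
  sublinear (fun x => inf [set F i x | i in D]).
Proof.
move=> [i0 Di0] lbF FD FZ.
have F0 x : [set F i x | i in D] !=set0 by exists (F i0 x), i0.
have leF i x : D i -> inf [set F i x | i in D] <= F i x.
  by move=> Di; apply: ge_inf => //; exists i.
split=> [x y|t x].
  apply: le_inf_add => // _ _ [i Di <-] [j Dj <-].
  by have [k Dk] := FD i j x y Di Dj; apply: le_trans; exact: leF.
rewrite le_eqVlt => /predU1P[<-|t0].
  have [k Dk] := FZ i0 0 x Di0 (lexx 0).
  by rewrite !mul0r; apply: le_trans; exact: leF.
rewrite -ler_pdivrMl//; apply: lb_le_inf => // _ [i Di <-].
rewrite ler_pdivrMl//.
by have [k Dk] := FZ i t x Di (ltW t0); apply: le_trans; exact: leF.
Qed.

(** Zorn's lemma: a chain of sublinear functionals below [p] is bounded below at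
    [x] by [- p (- x)], so its pointwise infimum is again sublinear. *)
Lemma minimal_sublinear p : sublinear p -> exists q, [/\ sublinear q,
  forall x, q x <= p x &
  forall q', sublinear q' -> (forall x, q' x <= q x) -> q' = q].
Proof.
move=> sp.
pose P q := sublinear q /\ forall x, q x <= p x.
pose S := {q : V -> R | P q}.
pose ge (q r : S) := `[< forall x, sval r x <= sval q x >].
have [||||[q [sq qp]] qmin] := @Zorn S ge.
- by move=> q; apply/asboolP.
- move=> q r s /asboolP qr /asboolP rs; apply/asboolP => x.
  exact: le_trans (rs x) (qr x).
- move=> [q Pq] [r Pr] /asboolP/= qr /asboolP/= rq; apply: eq_exist.
  by apply/funext => x; apply/eqP; rewrite eq_le qr rq.
- move=> A Atot; have [A0|/set0P An0] := eqVneq A set0.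
    exists (exist P p (conj sp (fun x => lexx (p x)))) => s.
    by rewrite A0 => -[].
  have lbA x : has_lbound [set sval q x | q in A].
    exists (- p (- x)) => _ [[q [sq qp]] _ <-] /=.
    by apply: le_trans (sublinearN_ge x sq); rewrite lerN2.
  have leA (q : S) x : A q -> inf [set sval q x | q in A] <= sval q x.
    by move=> Aq; apply: ge_inf => //; exists q.
  have sI : sublinear (fun x => inf [set sval q x | q in A]).
    apply: inf_sublinear => //.
      move=> q r x y Aq Ar.
      have [/asboolP qr|/asboolP rq] := Atot _ _ Aq Ar.
        exists r => //; have [[+ _] _] := svalP r.
        by move=> /(_ x y)/le_trans; apply; rewrite lerD2r.
      exists q => //; have [[+ _] _] := svalP q.
      by move=> /(_ x y)/le_trans; apply; rewrite lerD2l.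
    move=> q t x Aq t0; exists q => //; have [[_ +] _] := svalP q.
    exact.
  have Ip x : inf [set sval q x | q in A] <= p x.
    have [q Aq] := An0; apply: le_trans (leA q x Aq) _.
    by have [_] := svalP q.
  by exists (exist P _ (conj sI Ip)) => q Aq; apply/asboolP => x; exact: leA.
exists q; split=> // q' sq' q'q.
have q'p x : q' x <= p x := le_trans (q'q x) (qp x).
have := qmin (exist _ q' (conj sq' q'p)); rewrite /ge /=.
by move=> /(_ (asboolT q'q)) [].
Qed.

(** The pairs [(a, c)] of [C] are constraints [- c <= q a]; if [p] satisfies
    them, then [inf (p (x + a) + c)] over the cone is sublinear, lies below [p]
    and forces them on every linear functional below it, since it is at most [c]
    at [- a].  Extending a functional and proving that minimal functionals are
    linear are both done by a choice of [C]. *)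
Lemma cone_minorant p (C : V -> R -> Prop) : sublinear p ->
  C 0 0 -> (forall a b c d, C a c -> C b d -> C (a + b) (c + d)) ->
  (forall (t : R) a c, 0 <= t -> C a c -> C (t *: a) (t * c)) ->
  (forall a c, C a c -> 0 <= p a + c) ->
  exists q, [/\ sublinear q, forall x, q x <= p x &
                forall a c, C a c -> q (- a) <= c].
Proof.
move=> sp C0 CD CZ Cp; have [pD pZ] := sp.
pose D := [set i | C i.1 i.2].
pose F (i : V * R) x := p (x + i.1) + i.2.
have lbF x : has_lbound [set F i x | i in D].
  exists (- p (- x)) => _ [[a c] /Cp /= ac <-]; rewrite /F/= lerNl.
  rewrite -subr_ge0 opprK addrCA addrA (le_trans ac)// lerD2r.
  by rewrite -{1}(addKr x a) (le_trans (pD _ _))// addrC.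
have leF i x : D i -> inf [set F i x | i in D] <= F i x.
  by move=> Di; apply: ge_inf => //; exists i.
exists (fun x => inf [set F i x | i in D]); split.
- apply: inf_sublinear => //; first by exists (0, 0).
    move=> [a c] [b d] x y; rewrite /D/F/= => ac bd.
    exists (a + b, c + d) => /=; first exact: CD.
    by rewrite addrACA [leRHS]addrACA lerD2r pD.
  move=> [a c] t x; rewrite /D/F/= => ac t0.
  exists (t *: a, t * c) => /=; first exact: CZ.
  by rewrite -scalerDr mulrDr lerD2r pZ.
- move=> x; have /= := leF (0, 0) x C0.
  by rewrite {2}/F /= !addr0.
- move=> a c ac; have /= := leF (a, c) (- a) ac.
  by rewrite {2}/F /= addNr (sublinear0 sp) add0r.
Qed.

(** The cone is the ray of the pairs [(t *: y, - (t * p y))], so the minorant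
    is at most [- p y] at [- y]; by minimality the minorant is [p] itself. *)
Lemma minimal_sublinear_odd p : sublinear p ->
  (forall q, sublinear q -> (forall x, q x <= p x) -> q = p) ->
  forall x, p (- x) = - p x.
Proof.
move=> sp pmin y; apply/eqP; rewrite eq_le; apply/andP; split; last first.
  by rewrite lerNl sublinearN_ge.
have [||||q [sq qp qC]] := @cone_minorant p
  (fun a c => exists2 t, 0 <= t & a = t *: y /\ c = - (t * p y)) sp.
- by exists 0; rewrite ?scale0r ?mul0r ?oppr0.
- move=> _ _ _ _ [t t0 [-> ->]] [s s0 [-> ->]]; exists (t + s).
    exact: addr_ge0.
  by rewrite scalerDl mulrDl opprD.
- move=> t _ _ t0 [s s0 [-> ->]]; exists (t * s); first exact: mulr_ge0.
  by rewrite scalerA mulrN mulrA.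
- move=> _ _ [t t0 [-> ->]]; have [_ pZ] := sp.
  rewrite subr_ge0; move: t0; rewrite le_eqVlt => /predU1P[<-|t0].
    by rewrite mul0r scale0r (sublinear0 sp).
  rewrite -ler_pdivlMl//.
  have := pZ t^-1 (t *: y); rewrite scalerA mulVf ?gt_eqF// scale1r.
  by apply; rewrite invr_ge0 ltW.
- rewrite -(pmin q sq qp) (le_trans (qC y (- p y) _))//.
    by exists 1; rewrite ?scale1r ?mul1r.
  by rewrite (pmin q sq qp).
Qed.

(** An odd subadditive functional is also superadditive. *)
Lemma minimal_sublinear_linear p : sublinear p ->
  (forall q, sublinear q -> (forall x, q x <= p x) -> q = p) -> scalar p.
Proof.
move=> sp pmin; have podd := minimal_sublinear_odd sp pmin.
have [pD pZ] := sp.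
have pDE x y : p (x + y) = p x + p y.
  apply/eqP; rewrite eq_le pD/= -[x + y]opprK podd lerNr !opprD.
  by rewrite -!podd pD.
have pZp t x : 0 <= t -> p (t *: x) = t * p x.
  move=> t0; apply/eqP; rewrite eq_le pZ//=.
  rewrite -[t *: x]opprK podd -scalerN lerNr -mulrN -podd.
  exact: pZ.
move=> t x y; rewrite pDE; congr (_ + _).
have [t0|t0] := leP 0 t; first exact: pZp.
by rewrite -[t]opprK scaleNr podd pZp ?oppr_ge0 ?ltW// !mulNr.
Qed.

(** The subspace is the image of [A], and the functional on it is given through
    [u]; that [u] factors through [A] is part of the conclusion and follows from
    the bound by [p].  The cone of the pairs [(- A f, u f)] produces a sublinear
    functional that is at most [u f] at [A f], and a linear functional below it
    must agree with [u] there. *)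
Theorem hahn_banach p (E : lmodType R) (A : {linear E -> V}) (u : {scalar E}) :
  sublinear p -> (forall f, u f <= p (A f)) ->
  exists v : {scalar V}, (forall x, v x <= p x) /\ (forall f, v (A f) = u f).
Proof.
move=> sp up.
have [||||q [sq qp qC]] := @cone_minorant p
  (fun a c => exists f, a = - A f /\ c = u f) sp.
- by exists 0; rewrite !linear0; split=> //; rewrite oppr0.
- move=> _ _ _ _ [f [-> ->]] [g [-> ->]]; exists (f + g).
  by rewrite !linearD.
- move=> t _ _ t0 [f [-> ->]]; exists (t *: f).
  by split; rewrite linearZ//= scalerN.
- move=> _ _ [f [-> ->]].
  by have := up (- f); rewrite !raddfN -subr_ge0 opprK.
have [v [sv vq vmin]] := minimal_sublinear sq.
pose w : {scalar V} := HB.pack v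
  (GRing.isLinear.Build R V R _ v (minimal_sublinear_linear sv vmin)).
exists w; split=> [x|f]; first exact: le_trans (vq x) (qp x).
have wA g : w (A g) <= u g.
  by rewrite (le_trans (vq _))// -[A g]opprK qC//; exists g.
apply/eqP; rewrite eq_le wA /=.
by have := wA (- f); rewrite !raddfN lerN2.
Qed.

End HahnBanach.

(** * Real and complex scalars, seminorms *)

Section Scalars.
Context (R : realType) (k : scalar_kind).

Lemma rePart_ofReal (r : R) : rePart (ofReal k r) = r.
Proof. by case: k. Qed.

Lemma rePart0 : rePart (0 : scalars R k) = 0.
Proof. by case: k. Qed.

Lemma rePart1 : rePart (1 : scalars R k) = 1.
Proof. by case: k. Qed.

Lemma norm_ofReal (r : R) : `|ofReal k r| = ofReal k `|r|.
Proof. by case: k => //=; rewrite normc_def /= expr0n addr0 sqrtr_sqr. Qed.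

Lemma ofReal_rePart (a : scalars R k) : 0 < a -> ofReal k (rePart a) = a.
Proof. by case: k a => //= -[x y]; rewrite ltcE /= => /andP[/eqP -> _]. Qed.

Lemma ltr_ofReal (x y : R) : (ofReal k x < ofReal k y) = (x < y).
Proof. by case: k => //=; rewrite ltcR. Qed.

Lemma ofReal0 : ofReal k (0 : R) = 0. Proof. by case: k. Qed.

Lemma ofRealV (r : R) : (ofReal k r)^-1 = ofReal k r^-1.
Proof. by case: k => //=; rewrite fmorphV. Qed.

Lemma ofReal_sum (f : nat -> R) N :
  ofReal k (\sum_(0 <= n < N) f n) = \sum_(0 <= n < N) ofReal k (f n).
Proof. by case: k => //=; rewrite raddf_sum. Qed.

(** The phase of zero is taken to be zero. *)
Lemma unimodular (z : scalars R k) :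
  exists a : scalars R k, rePart `|a| <= 1 /\ a * z = ofReal k (rnorm z).
Proof.
have [->|z0] := eqVneq z 0.
  by exists 0; rewrite normr0 rePart0 mul0r rnorm0 ofReal0.
exists (`|z| / z); rewrite divfK// -normE_rnorm normrM normr_id normfV.
by rewrite divff ?normr_eq0// rePart1.
Qed.

End Scalars.

Section Seminorms.
Context (R : realType) (k : scalar_kind).

Definition seminorm (V : lmodType (scalars R k)) (p : V -> R) :=
  (forall x y, p (x + y) <= p x + p y) /\
  (forall (a : scalars R k) x, p (a *: x) = rePart `|a| * p x).

Section seminorm_theory.
Context (V : lmodType (scalars R k)) (p : V -> R).
Hypothesis sp : seminorm p.

Lemma seminorm0 : p 0 = 0.
Proof.
by have [_ /(_ 0 0)] := sp; rewrite scale0r normr0 rePart0 mul0r.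
Qed.

Lemma seminormN x : p (- x) = p x.
Proof.
by have [_ /(_ (-1) x)] := sp; rewrite scaleN1r normrN1 rePart1 mul1r.
Qed.

Lemma seminorm_ge0 x : 0 <= p x.
Proof.
have [/(_ x (- x)) + _] := sp.
by rewrite subrr seminorm0 seminormN -mulr2n pmulrn_lge0.
Qed.

End seminorm_theory.

(** Homogeneity follows from the inequality applied to [a] and to [a^-1]. *)
Lemma seminorm_le (V : lmodType (scalars R k)) (p : V -> R) :
  (forall x y, p (x + y) <= p x + p y) ->
  (forall (a : scalars R k) x, p (a *: x) <= rePart `|a| * p x) -> seminorm p.
Proof.
move=> pD pZ; split=> // a x; apply/eqP; rewrite eq_le pZ/=.
have p0 : p 0 <= 0 by have := pZ 0 0; rewrite scale0r normr0 rePart0 mul0r.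
have [->|a0] := eqVneq a 0.
  by rewrite scale0r normr0 rePart0 mul0r; have := pD 0 0; rewrite addr0 lerDl.
have a1 : rePart `|a| * rePart `|a^-1| = 1.
  have := rnormZ a (a^-1 : scalars R k); rewrite /rnorm => <-.
  by rewrite /GRing.scale/= divff// normr1 rePart1.
have := pZ a^-1 (a *: x); rewrite scalerA mulVf// scale1r => pa.
by rewrite (le_trans (ler_wpM2l (rePart_norm_ge0 a) pa))// mulrA a1 mul1r.
Qed.

Lemma rnorm_seminorm (V : normedModType (scalars R k)) :
  seminorm (fun v : V => rnorm v).
Proof. by split=> [v w|a v]; [exact: rnormD|exact: rnormZ]. Qed.

Lemma rnorm_ge0 (V : normedModType (scalars R k)) (v : V) : 0 <= rnorm v.
Proof. exact: (seminorm_ge0 (rnorm_seminorm V)). Qed.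

Lemma rnormN (V : normedModType (scalars R k)) (v : V) : rnorm (- v) = rnorm v.
Proof. exact: (seminormN (rnorm_seminorm V)). Qed.

(** The topology of a normed space over either field, described with real
    radii. *)
Lemma cvg_rnormP (V : normedModType (scalars R k)) (T : Type)
    (G : set_system T) (FG : Filter G) (f : T -> V) (v : V) :
  f @ G --> v <-> forall e : R, 0 < e -> \forall t \near G, rnorm (v - f t) < e.
Proof.
split=> [/cvgrPdist_lt fv e e0|fv].
  have := fv (ofReal k e); rewrite -ofReal0 ltr_ofReal => /(_ e0).
  by apply: filterS => t; rewrite normE_rnorm ltr_ofReal.
apply/cvgrPdist_lt => a a0; have := fv (rePart a).
rewrite -(ltr_ofReal k) ofReal0 (ofReal_rePart a0) => /(_ a0).
apply: filterS => t; rewrite -(ltr_ofReal k) (ofReal_rePart a0).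
by rewrite -normE_rnorm.
Qed.

Lemma rnorm_sum (V : normedModType (scalars R k)) (f : nat -> V) N :
  rnorm (\sum_(0 <= n < N) f n) <= \sum_(0 <= n < N) rnorm (f n).
Proof.
elim/big_ind2 : _ => [|u a v b ua vb|//]; first by rewrite rnorm0.
by rewrite (le_trans (rnormD _ _))// lerD.
Qed.

(** Rescaling [x] to [(r / s) *: x] for [s] slightly larger than [q x] avoids
    a case distinction on [q x = 0]. *)
Lemma scalar_bound_of_ball (E : lmodType (scalars R k)) (q : E -> R)
    (T : {scalar E}) (r : R) : seminorm q -> 0 < r ->
  (forall x, q x < r -> rnorm (T x) < 1) ->
  forall x, rnorm (T x) <= r^-1 * q x.
Proof.
move=> sq r0 qr x; rewrite ler_pdivlMl//; apply/ler_addgt0Pr => e e0.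
have [_ qZ] := sq.
set s := q x + e; have s0 : 0 < s by rewrite ltr_wpDl// seminorm_ge0.
have := qr (ofReal k (r / s) *: x).
rewrite qZ scalarZ (rnormZ (ofReal k (r / s)) (T x : scalars R k)).
rewrite norm_ofReal rePart_ofReal gtr0_norm ?divr_gt0//.
rewrite mulrAC ltr_pdivrMr// ltr_pM2l// ltrDl => /(_ e0).
by rewrite mulrAC ltr_pdivrMr// mul1r => /ltW.
Qed.

End Seminorms.

(** * The Hahn-Banach theorem for seminorms over either field *)

Section ScalarExtension.
Context (R : realType).

Section Realification.
Variable V : lmodType R[i].

(** A copy of a complex vector space, to carry its structure of real vector
    space. *)
Definition realification : Type := V.
HB.instance Definition _ := GRing.Zmodule.on realification.

Definition real_scale (r : R) (x : realification) : realification :=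
  (r%:C)%C *: (x : V).

Fact real_scaleA a b x : real_scale a (real_scale b x) = real_scale (a * b) x.
Proof. by rewrite /real_scale scalerA rmorphM. Qed.
Fact real_scale1 : left_id 1 real_scale.
Proof. by move=> x; rewrite /real_scale rmorph1 scale1r. Qed.
Fact real_scaleDr : right_distributive real_scale +%R.
Proof. by move=> r x y; exact: scalerDr. Qed.
Fact real_scaleDl x : {morph real_scale^~ x : a b / a + b}.
Proof. by move=> a b; rewrite /real_scale rmorphD scalerDl. Qed.

HB.instance Definition _ := GRing.Zmodule_isLmodule.Build R realification
  real_scaleA real_scale1 real_scaleDr real_scaleDl.

End Realification.

(** A complex functional is determined by its real part [v] through
    [S x = v x - i * v (i * x)].  The bound on [v] gives the one on [S] by
    evaluation at [(S x)^* *: x], where [S] takes the real value [|S x| ^ 2]. *)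
Theorem complex_hahn_banach (E V : lmodType R[i]) (p : V -> R)
    (A : {linear E -> V}) (T : {scalar E}) :
  @seminorm R ComplexScalars V p -> (forall f, complex.Re `|T f| <= p (A f)) ->
  exists S : {scalar V},
    (forall x, complex.Re `|S x| <= p x) /\ (forall f, S (A f) = T f).
Proof.
move=> [pD pZ] Tp.
have Alin : linear (A : realification E -> realification V).
  by move=> a x y; exact: (linearP A).
pose A' : {linear realification E -> realification V} := HB.pack
  (A : realification E -> realification V)
  (GRing.isLinear.Build _ _ _ _ _ Alin).
have ulin : scalar (fun f : realification E => complex.Re (T f)).
  move=> a x y /=; rewrite (linearP T) raddfD /=; congr (_ + _).
  by case: (T x) => r s /=; rewrite mul0r subr0.
pose u : {scalar realification E} := HB.pack
  (fun f : realification E => complex.Re (T f))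
  (GRing.isLinear.Build _ _ _ _ _ ulin).
have [||v [vp vA]] := @hahn_banach R (realification V) p (realification E) A' u.
- split=> // t x t0; rewrite (pZ (t%:C)%C) normc_def /= expr0n addr0 sqrtr_sqr.
  by rewrite ger0_norm.
- move=> f /=; apply: le_trans (Tp f); case: (T f) => r s.
  rewrite normc_def /= (le_trans (ler_norm _))// -sqrtr_sqr ler_sqrt.
    by rewrite lerDl sqr_ge0.
  by rewrite addr_ge0 ?sqr_ge0.
pose S (x : V) : R[i] := (v x +i* (- v ('i%C *: x)))%C.
have vD (x y : V) : v (x + y) = v x + v y by exact: (raddfD v).
have vZ (r : R) (x : V) : v (r%:C%C *: x) = r * v x by exact: (scalarZ v).
(* [v] is only real-linear, but its values on the complex line of [x] follow
   from those at [x] and ['i *: x]. *)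
have vDZ (r s : R) (x : V) :
    v ((r +i* s)%C *: x) = r * v x + s * v ('i%C *: x).
  have -> : (r +i* s = r%:C + s%:C * 'i)%C.
    by apply/eqP; rewrite eq_complex /=; apply/andP; split; apply/eqP; ring.
  by rewrite scalerDl -scalerA vD !vZ.
have Slin : scalar S.
  move=> [r s] x y; rewrite /S scalerDr scalerA !vD (vDZ r s).
  have -> : ('i * (r +i* s) = (- s) +i* r)%C.
    by apply/eqP; rewrite eq_complex /=; apply/andP; split; apply/eqP; ring.
  rewrite (vDZ (- s) r); apply/eqP; rewrite eq_complex /=.
  by apply/andP; split; apply/eqP; ring.
pose S' : {scalar V} := HB.pack S (GRing.isLinear.Build _ _ _ _ _ Slin).
exists S'; split=> [x|f]; last first.
  rewrite /= /S; have := vA f; have := vA ('i%C *: f).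
  rewrite /= linearZ /= => -> ->; rewrite scalarZ.
  by case: (T f) => r s /=; rewrite !mul0r mul1r sub0r opprK.
have := vp ((S x)^*%C *: x); rewrite pZ.
have := congr1 (fun z => complex.Re z) (scalarZ S' (S x)^*%C x) => /= ->.
have := @seminorm_ge0 R ComplexScalars V p (conj pD pZ) x.
rewrite /rePart /=; move: (v x) (- v _) => r s p0.
rewrite sqrrN mulNr opprK -!expr2.
(* The inequality is now [w ^ 2 <= w * p x] with [w = |S x|]. *)
set w := Num.sqrt _.
rewrite -(sqr_sqrtr (addr_ge0 (sqr_ge0 r) (sqr_ge0 s))) -/w.
have := sqrtr_ge0 (r ^+ 2 + s ^+ 2); rewrite -/w le_eqVlt => /predU1P[<-//|w0].
by rewrite expr2 ler_pM2l.
Qed.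

Theorem scalars_hahn_banach (k : scalar_kind) (E V : lmodType (scalars R k))
    (p : V -> R) (A : {linear E -> V}) (T : {scalar E}) :
  seminorm p -> (forall f, rnorm (T f) <= p (A f)) ->
  exists S : {scalar V},
    (forall x, rnorm (S x) <= p x) /\ (forall f, S (A f) = T f).
Proof.
case: k E V p A T => E V p A T [pD pZ] Tp; last first.
  by apply: complex_hahn_banach => //; split.
have [||S [Sp SA]] := @hahn_banach R V p E A T.
- by split=> // t x t0; rewrite pZ /= ger0_norm.
- by move=> f; apply: le_trans (Tp f); exact: ler_norm.
exists S; split=> // x; rewrite /rnorm /= ler_norml Sp andbT lerNl.
rewrite -raddfN (le_trans (Sp _))// -scaleN1r pZ /=.
by rewrite normrN1 mul1r.
Qed.

End ScalarExtension.

(** * Continuity for a directed family of seminorms *)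

Section DirectedSeminorms.
Context (R : realType) (k : scalar_kind) (E : lmodType (scalars R k)).
Variable Q : set (E -> R).
Hypothesis Qsemi : forall q, Q q -> seminorm q.
Hypothesis Q0 : Q !=set0.
Hypothesis Qdir : forall q1 q2, Q q1 -> Q q2 ->
  exists2 q, Q q & forall x, q1 x <= q x /\ q2 x <= q x.

Lemma seminorm_ball_nbhs q (c : seminorm_topology Q) r : Q q -> 0 < r ->
  nbhs c [set x : seminorm_topology Q | q (x - c) < r].
Proof.
move=> Qq r0; rewrite nbhsE; set B := [set x | q (x - c) < r].
exists B => //; split.
  exists [set B]; last by rewrite bigcup_set1.
  move=> _ ->; apply: (@finI_from1 _ _ _ id B).
  by exists q, c, r.
by rewrite /B /= subrr (seminorm0 (Qsemi Qq)).
Qed.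

(** A subbasic ball with an arbitrary centre [c] that contains zero contains the
    centred ball of radius [r - q (- c)]; directedness makes the centred balls a
    filter base, so finite intersections are harmless. *)
Lemma nbhs0_seminorm_ball A : nbhs (0 : seminorm_topology Q) A ->
  exists q r, [/\ Q q, 0 < r & forall x, q x < r -> A x].
Proof.
pose N := filter_from [set i : (E -> R) * R | Q i.1 /\ 0 < i.2]
  (fun i => [set x : E | i.1 x < i.2]).
have FN : Filter N.
  apply: filter_from_filter.
    by have [q Qq] := Q0; exists (q, 1); split => /=.
  move=> [q1 r1] [q2 r2] [/= Qq1 r10] [/= Qq2 r20].
  have [q Qq q12] := Qdir Qq1 Qq2.
  exists (q, Num.min r1 r2); first by split; rewrite //= lt_min r10.
  move=> x /=; have [q1x q2x] := q12 x.
  by rewrite lt_min => /andP[/(le_lt_trans q1x) ? /(le_lt_trans q2x) ?].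
rewrite nbhsE => -[_ [[B sB <-] [C BC C0]] sCA].
suff [[q r] [/= Qq r0] qrC] : N C.
  by exists q, r; split=> // x /qrC Cx; apply: sCA; exists C.
have /sB [D sD DC] := BC; rewrite -DC; apply: filter_bigI => U DU.
have /sD := DU; rewrite inE => -[q [c [r [Qq r0 UE]]]].
have : U 0 by move: C0; rewrite -DC => /(_ _ DU).
rewrite UE /= sub0r => qc.
exists (q, r - q (- c)); first by split; rewrite //= subr_gt0.
move=> x /=; rewrite ltrBrDr; apply: le_lt_trans.
by have [qD _] := Qsemi Qq; exact: qD.
Qed.

Theorem continuous_seminormP (T : {scalar E}) :
  continuous (T : seminorm_topology Q -> scalars R k) <->
  exists q C, [/\ Q q, 0 < C & forall x, rnorm (T x) <= C * q x].
Proof.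
split=> [Tc|[q [C [Qq C0 Tq]]] c]; last first.
  apply/(cvg_rnormP (nbhs_filter c)) => e e0.
  have /(seminorm_ball_nbhs c Qq) : 0 < e / C by rewrite divr_gt0.
  apply: filterS => x; rewrite /= ltr_pdivlMr// mulrC; apply: le_lt_trans.
  by rewrite -rnormN opprB -raddfB; exact: Tq.
have /(cvg_rnormP (nbhs_filter _))/(_ 1 ltr01) := Tc 0.
move=> /nbhs0_seminorm_ball[q [r [Qq r0 qr]]].
exists q, r^-1; split; rewrite ?invr_gt0//.
apply: (scalar_bound_of_ball (Qsemi Qq) r0) => x /qr.
by rewrite linear0 sub0r rnormN.
Qed.

End DirectedSeminorms.

(** * Null sequences and their dual *)

Section NullSequences.
Context (R : realType) (k : scalar_kind) (F : normedModType (scalars R k)).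

Definition null_pred : {pred nat -> F} :=
  mem [set u : nat -> F | u @ \oo --> (0 : F)].

Lemma null_submod_closed : submod_closed null_pred.
Proof.
split; first by rewrite inE /=; exact: cvg_cst.
move=> a u v; rewrite !inE /= => u0 v0.
rewrite (_ : 0 = a *: 0 + 0 :> F); last by rewrite scaler0 addr0.
by apply: cvgD => //; apply: cvgZr.
Qed.

HB.instance Definition _ :=
  GRing.isSubmodClosed.Build _ _ null_pred null_submod_closed.

Record c0 := C0 { c0_fun :> nat -> F ; _ : c0_fun \in null_pred }.

HB.instance Definition _ := [isSub for c0_fun].
HB.instance Definition _ := [Choice of c0 by <:].
HB.instance Definition _ := [SubChoice_isSubLmodule of c0 by <:].

Implicit Types (u w : c0) (v : F).

Lemma c0_cvg u : u @ \oo --> (0 : F).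
Proof. by case: u => u /=; rewrite inE. Qed.

Lemma c0D u w n : (u + w) n = u n + w n.
Proof. by []. Qed.

Lemma c0N u n : (- u) n = - u n.
Proof. by []. Qed.

Lemma c0Z a u n : (a *: u) n = a *: u n.
Proof. by []. Qed.

Definition c0_norm u : R := sup (range (fun n => rnorm (u n))).

Lemma rnorm_cvg0 (f : nat -> F) : f @ \oo --> (0 : F) ->
  (fun n => rnorm (f n)) @ \oo --> (0 : R).
Proof.
move=> f0; apply/cvgrPdist_lt => e e0.
have /(cvg_rnormP _)/(_ e e0) := f0.
by apply: filterS => n; rewrite !sub0r normrN rnormN ger0_norm// rnorm_ge0.
Qed.

Lemma rnorm_le_c0_norm u n : rnorm (u n) <= c0_norm u.
Proof.
apply: ub_le_sup; last by exists n.
apply/bounded_fun_has_ubound/cvg_seq_bounded/cvg_ex.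
by exists 0; exact: rnorm_cvg0 (c0_cvg u).
Qed.

Lemma c0_norm_le u M : (forall n, rnorm (u n) <= M) -> c0_norm u <= M.
Proof.
move=> uM; apply: ge_sup; first by exists (rnorm (u 0)), 0%N.
by move=> _ [n _ <-].
Qed.

Lemma c0_norm_seminorm : seminorm c0_norm.
Proof.
apply: seminorm_le => [u w|a u]; apply: c0_norm_le => n.
  by rewrite c0D (le_trans (rnormD _ _))// lerD// rnorm_le_c0_norm.
by rewrite c0Z rnormZ ler_wpM2l ?rnorm_le_c0_norm// rePart_norm_ge0.
Qed.

Definition single_fun (m : nat) v (n : nat) : F := if n == m then v else 0.

Fact single_null m v : single_fun m v \in null_pred.
Proof.
rewrite inE /=; apply: cvg_near_cst.
by exists m.+1 => // n /= mn; rewrite /single_fun gtn_eqF.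
Qed.

Definition single m v : c0 := C0 (single_null m v).

Fact single_linear m : linear (single m).
Proof.
move=> a v w; apply/val_inj/funext => n.
rewrite [RHS]c0D c0Z /= /single_fun.
by case: eqP => //; rewrite scaler0 addr0.
Qed.

HB.instance Definition _ m :=
  GRing.isLinear.Build (scalars R k) F c0 _ (single m) (single_linear m).

Lemma c0_norm_single n v :
  c0_norm (single n v) <= rnorm v.
Proof.
apply: c0_norm_le => m; rewrite /= /single_fun; case: eqP => // _.
by rewrite rnorm0 rnorm_ge0.
Qed.

Lemma c0_sumE (N : nat) (U : nat -> c0) n :
  (\sum_(0 <= i < N) U i) n = \sum_(0 <= i < N) U i n.
Proof. by elim/big_ind2 : _ => // x f y g <- <-. Qed.

Lemma sum_singleE N (f : nat -> F) n :
  (\sum_(0 <= i < N) single i (f i)) n = if (n < N)%N then f n else 0.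
Proof.
rewrite c0_sumE; have [nN|Nn] := ltnP n N; last first.
  rewrite big_nat_cond big1// => i /andP[/andP[_ iN] _].
  by rewrite /= /single_fun gtn_eqF// (leq_trans iN).
rewrite (bigD1_seq n) ?iota_uniq ?mem_index_iota//= /single_fun eqxx.
by rewrite big1 ?addr0// => i ni; rewrite eq_sym (negbTE ni).
Qed.

Context (S : {scalar c0}) (C : R).
Hypothesis SC : forall u, rnorm (S u) <= C * c0_norm u.
Hypothesis C_ge0 : 0 <= C.

(** The distance from [u] to its truncations tends to zero in sup norm. *)
Lemma c0_dual_sum u : series (fun n => S (single n (u n))) @ \oo --> S u.
Proof.
apply/cvg_rnormP => e e0.
(* [C] may be zero, hence the denominator [C + 1]. *)
have /(cvg_rnormP _)/(_ (e / (C + 1))) := c0_cvg u.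
rewrite divr_gt0// ?ltr_wpDl// => /(_ isT)[N _ uN].
exists N => // n /= Nn; rewrite seriesEnat /= -raddf_sum -raddfB.
apply: (le_lt_trans (SC _)).
have : c0_norm (u - \sum_(0 <= i < n) single i (u i)) <= e / (C + 1).
  apply: c0_norm_le => i; rewrite c0D c0N.
  rewrite sum_singleE; case: ltnP => ni.
    by rewrite subrr rnorm0 divr_ge0 ?addr_ge0// ltW.
  by have := uN i (leq_trans Nn ni); rewrite sub0r subr0 rnormN => /ltW.
move=> /(ler_wpM2l C_ge0)/le_lt_trans; apply.
by rewrite mulrA ltr_pdivrMr ?ltr_wpDl// mulrC ltr_pM2l// ltrDl.
Qed.

(** After multiplication by the phases of [unimodular], the values of [S] on the
    single terms add up without cancellation, while the sup norm of the finite
    sequence stays at most [M]. *)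
Lemma c0_dual_abs_sum (M : R) (f : nat -> F) N : 0 <= M ->
  (forall n, rnorm (f n) <= M) ->
  \sum_(0 <= n < N) rnorm (S (single n (f n))) <= C * M.
Proof.
move=> M0 fM.
have /choice[a aS] := fun n => unimodular (S (single n (f n))).
pose w := \sum_(0 <= n < N) single n (a n *: f n).
have Sw : S w = ofReal k (\sum_(0 <= n < N) rnorm (S (single n (f n)))).
  rewrite raddf_sum ofReal_sum; apply: eq_bigr => n _.
  by rewrite linearZ/= scalarZ; have [_] := aS n.
have := SC w; rewrite Sw /rnorm norm_ofReal rePart_ofReal ger0_norm; last first.
  by apply: sumr_ge0 => n _; exact: rnorm_ge0.
move=> /le_trans; apply; rewrite ler_wpM2l//; apply: c0_norm_le => n.
rewrite sum_singleE; case: ifP => _; last by rewrite rnorm0.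
rewrite rnormZ -[M]mul1r ler_pM ?rePart_norm_ge0 ?rnorm_ge0//.
by have [] := aS n.
Qed.

End NullSequences.

(** * The norm of the dual *)

Section DualNorm.
Context (R : realType) (k : scalar_kind) (F : normedModType (scalars R k)).
Implicit Type phi : {scalar F}.

Lemma continuous_scalarP phi : continuous (phi : F -> scalars R k) <->
  exists C, 0 < C /\ forall v, rnorm (phi v) <= C * rnorm v.
Proof.
split=> [phic|[C [C0 phiC]] c]; last first.
  apply/(cvg_rnormP (nbhs_filter c)) => e e0.
  have := (cvg_rnormP (nbhs_filter c) id c).1 cvg_id (e / C).
  rewrite divr_gt0// => /(_ isT); apply: filterS => x.
  rewrite ltr_pdivlMr// mulrC -raddfB; apply: le_lt_trans.
  exact: phiC.
have /(cvg_rnormP (nbhs_filter _))/(_ 1 ltr01) := phic 0.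
move=> /nbhs_norm0P[a /= a0 aphi].
have ra0 : 0 < rePart a by rewrite -(ltr_ofReal k) ofReal0 ofReal_rePart.
exists (rePart a)^-1; split; first by rewrite invr_gt0.
apply: (scalar_bound_of_ball (rnorm_seminorm F) ra0) => v va.
have := aphi v; rewrite /= linear0 sub0r rnormN; apply.
by rewrite normE_rnorm -(ofReal_rePart a0) ltr_ofReal.
Qed.

Lemma has_sup_dual_norm phi : continuous (phi : F -> scalars R k) ->
  has_sup [set rnorm (phi v) | v in [set v : F | rnorm v <= 1]].
Proof.
move=> /continuous_scalarP[C [C0 phiC]]; split.
  by exists (rnorm (phi 0)), 0; rewrite //= rnorm0.
exists C => _ [v /= v1 <-]; rewrite (le_trans (phiC v))// -[leRHS]mulr1.
by rewrite ler_pM2l.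
Qed.

Lemma dual_norm_ge0 phi : continuous (phi : F -> scalars R k) ->
  0 <= dual_norm phi.
Proof.
move=> /has_sup_dual_norm[_ /ub_le_sup]; apply.
by exists 0; rewrite /= ?linear0 rnorm0.
Qed.

Lemma rnorm_le_dual_norm phi v : continuous (phi : F -> scalars R k) ->
  rnorm (phi v) <= dual_norm phi * rnorm v.
Proof.
move=> phic; have [C [C0 phiC]] := (continuous_scalarP phi).1 phic.
have [v0|v0] := leP (rnorm v) 0.
  have v0' : rnorm v = 0 by apply/le_anti; rewrite v0 rnorm_ge0.
  by have := phiC v; rewrite v0' !mulr0.
rewrite -ler_pdivrMr//; apply: ub_le_sup.
  by case: (has_sup_dual_norm phic).
exists (ofReal k (rnorm v)^-1 *: v).
  rewrite /= rnormZ norm_ofReal rePart_ofReal gtr0_norm ?invr_gt0//.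
  by rewrite mulVf ?gt_eqF.
rewrite scalarZ (rnormZ _ (phi v : scalars R k)) norm_ofReal rePart_ofReal.
by rewrite gtr0_norm ?invr_gt0// mulrC.
Qed.

(** A finite sum of suprema is approached by choosing the vectors [f n]
    independently. *)
Lemma sum_dual_norm_le (phi : nat -> {scalar F}) (B : R) N :
  (forall n, continuous (phi n : F -> scalars R k)) ->
  (forall f : nat -> F, (forall n, rnorm (f n) <= 1) ->
     \sum_(0 <= n < N) rnorm (phi n (f n)) <= B) ->
  \sum_(0 <= n < N) dual_norm (phi n) <= B.
Proof.
move=> phic phiB; apply/ler_addgt0Pr => e e0.
(* [N.+1] shares of [e], so that the share is defined for [N = 0] as well. *)
have eN0 : 0 < e / N.+1%:R by rewrite divr_gt0.
have /choice[f fP] n : exists v : F,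
    rnorm v <= 1 /\ dual_norm (phi n) - e / N.+1%:R < rnorm (phi n v).
  have [_ [v /= v1 <-] ve] := sup_adherent eN0 (has_sup_dual_norm (phic n)).
  by exists v.
have := phiB f (fun n => (fP n).1); rewrite -(lerD2r e); apply: le_trans.
have -> : e = \sum_(0 <= n < N.+1) (e / N.+1%:R).
  by rewrite sumr_const_nat subn0 -[RHS]mulr_natr divfK.
rewrite big_nat_recr//= addrA -big_split/=.
apply: ler_wpDr; first exact: ltW.
by apply: ler_sum => n _; rewrite -lerBlDr ltW// (fP n).2.
Qed.

End DualNorm.

(** * Weights of a summable sequence *)

(** With [r n] the tail of the series from [n] on, made positive by adding
    [1 / (n + 1)], the weights are [sqrt (r n)]: as [a n <= r n - r n.+1], the
    quotient [a n / sqrt (r n)] is at most [2 * (sqrt (r n) - sqrt (r n.+1))],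
    which telescopes. *)
Lemma summable_weights (R : realType) (a : nat -> R) (B : R) :
  (forall n, 0 <= a n) -> (forall N, \sum_(0 <= n < N) a n <= B) ->
  exists alpha : nat -> R, [/\ forall n, 0 < alpha n, alpha @ \oo --> (0 : R) &
    exists2 C, 0 < C & forall N, \sum_(0 <= n < N) a n / alpha n <= C].
Proof.
move=> a0 aB.
have nds : nondecreasing_seq (series a).
  by apply/nondecreasing_seqP => n; rewrite seriesSr lerDl.
have cs : cvgn (series a).
  apply: nondecreasing_is_cvgn => //; exists B => _ [N _ <-].
  by rewrite seriesEnat; exact: aB.
pose r n := limn (series a) - series a n + harmonic n.
have r0 n : 0 < r n.
  by rewrite ltr_wpDl ?harmonic_gt0// subr_ge0 nondecreasing_cvgn_le.
have ar n : a n <= r n - r n.+1.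
  rewrite /r seriesSr.
  have : harmonic n.+1 <= harmonic n :> R by rewrite lef_pV2 ?posrE// ler_nat.
  by lra.
have rc : r @ \oo --> (0 : R).
  rewrite (_ : 0 = limn (series a) - limn (series a) + 0); last first.
    by rewrite subrr addr0.
  apply: cvgD; last exact: cvg_harmonic.
  by apply: cvgB => //; exact: cvg_cst.
exists (fun n => Num.sqrt (r n)); split=> [n||]; first by rewrite sqrtr_gt0.
  rewrite -(sqrtr0 R).
  by apply: continuous_cvg rc; exact: sqrt_continuous.
exists (2 * Num.sqrt (r 0)); first by rewrite mulr_gt0// sqrtr_gt0.
move=> N; have leS n : a n / Num.sqrt (r n) <=
    2 * (- Num.sqrt (r n.+1) - - Num.sqrt (r n)).
  rewrite ler_pdivrMr ?sqrtr_gt0// (le_trans (ar n))//.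
  have rr : Num.sqrt (r n.+1) <= Num.sqrt (r n).
    by apply: ler_wsqrtr; have := ar n; have := a0 n; lra.
  have := sqrtr_ge0 (r n); have := sqrtr_ge0 (r n.+1); move: rr.
  have := sqr_sqrtr (ltW (r0 n)); have := sqr_sqrtr (ltW (r0 n.+1)).
  by nra.
rewrite (le_trans (ler_sum _ (fun n _ => leS n)))//.
rewrite -mulr_sumr telescope_sumr// ler_pM2l// opprK.
by rewrite gerDr oppr_le0 sqrtr_ge0.
Qed.

(** * Weighted difference quotients *)

Section DifferenceQuotients.
Context (R : realType) (k : scalar_kind) (X : metricType R) (x0 : X)
  (F : normedModType (scalars R k)).
Implicit Types (f g : Lip0 x0 F).

Definition quotient (x y : X) f : F :=
  (ofReal k (mdist x y))^-1 *: (f x - f y).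

Lemma rnorm_quotient (x y : X) f :
  rnorm (quotient x y f) = rnorm (f x - f y) / mdist x y.
Proof.
rewrite /quotient rnormZ normfV norm_ofReal ger0_norm ?mdist_ge0//.
by rewrite ofRealV rePart_ofReal mulrC.
Qed.

Lemma rnorm_quotient_bounded f : exists L, 0 < L /\
  forall x y : X, x <> y -> rnorm (quotient x y f) <= L.
Proof.
have [L fL] : is_lipschitz f by case: f => f /= /[!inE]-[].
exists (`|L| + 1); split; first by rewrite ltr_wpDl.
move=> x y /eqP xy; rewrite rnorm_quotient ler_pdivrMr ?mdist_gt0//=.
rewrite (le_trans (fL x y))// ler_wpM2r ?mdist_ge0//.
by rewrite (le_trans (ler_norm L))// lerDl.
Qed.

Section WeightedQuotients.
Variables (alpha : nat -> R) (x y : nat -> X).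
Hypothesis alpha_gt0 : forall n, 0 < alpha n.
Hypothesis alpha_cvg0 : alpha @ \oo --> (0 : R).
Hypothesis xy : forall n, x n <> y n.

Definition weighted_quotients_fun f n : F :=
  ofReal k (alpha n) *: quotient (x n) (y n) f.

Lemma rnorm_weighted_quotients f n : rnorm (weighted_quotients_fun f n) =
  alpha n * (rnorm (f (x n) - f (y n)) / mdist (x n) (y n)).
Proof.
by rewrite rnormZ norm_ofReal rePart_ofReal gtr0_norm// rnorm_quotient.
Qed.

Fact weighted_quotients_null f :
  weighted_quotients_fun f \in null_pred (F := F).
Proof.
rewrite inE /=; apply/cvg_rnormP => e e0.
have [L [L0 fL]] := rnorm_quotient_bounded f.
have /cvgrPdist_lt/(_ (e / L)) := alpha_cvg0.
rewrite divr_gt0// => /(_ isT); apply: filterS => n.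
rewrite !sub0r normrN rnormN gtr0_norm// ltr_pdivlMr//; apply: le_lt_trans.
by rewrite rnorm_weighted_quotients -rnorm_quotient ler_pM2l// fL.
Qed.

Definition weighted_quotients f : c0 F := C0 (weighted_quotients_null f).

Fact weighted_quotients_linear : linear weighted_quotients.
Proof.
move=> a f g; apply/val_inj/funext => n; rewrite [RHS]c0D c0Z /=.
rewrite /weighted_quotients_fun /quotient.
have -> u v : (a *: f + g) u - (a *: f + g) v =
    a *: (f u - f v) + (g u - g v) by rewrite scalerBr addrACA -opprD.
by rewrite !scalerDr !scalerA mulrC mulrA.
Qed.

HB.instance Definition _ := GRing.isLinear.Build (scalars R k) (Lip0 x0 F)
  (c0 F) _ weighted_quotients weighted_quotients_linear.

(** What makes the duality of [c0 F] bear on the topology of the Lipschitz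
    space. *)
Lemma gamma_seminormE f :
  gamma_seminorm alpha x y f = c0_norm (weighted_quotients f).
Proof.
congr (sup (image _ _)); apply/funext => n.
by rewrite -rnorm_weighted_quotients.
Qed.

Lemma gamma_seminorm_seminorm :
  seminorm (gamma_seminorm alpha x y : Lip0 x0 F -> R).
Proof.
have [cD cZ] := c0_norm_seminorm F.
split=> [f g|a f]; rewrite !gamma_seminormE.
  by rewrite linearD; exact: cD.
by rewrite linearZ; exact: cZ.
Qed.

Lemma quotient_le_gamma_seminorm f n :
  alpha n * rnorm (quotient (x n) (y n) f) <= gamma_seminorm alpha x y f.
Proof.
rewrite gamma_seminormE (le_trans _ (rnorm_le_c0_norm _ n))//=.
by rewrite rnorm_weighted_quotients rnorm_quotient.
Qed.

Lemma gamma_seminorm_le f M :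
  (forall n, alpha n * rnorm (quotient (x n) (y n) f) <= M) ->
  gamma_seminorm alpha x y f <= M.
Proof.
move=> fM; rewrite gamma_seminormE; apply: c0_norm_le => n /=.
by rewrite rnorm_weighted_quotients -rnorm_quotient.
Qed.

End WeightedQuotients.

Definition interleave (T : Type) (s t : nat -> T) n :=
  if odd n then t n./2 else s n./2.

Lemma interleave_double (T : Type) (s t : nat -> T) n :
  interleave s t n.*2 = s n.
Proof. by rewrite /interleave odd_double doubleK. Qed.

Lemma interleave_doubleS (T : Type) (s t : nat -> T) n :
  interleave s t n.*2.+1 = t n.
Proof. by rewrite /interleave /= odd_double /= uphalf_double. Qed.

Lemma interleave_cvg (s t : nat -> R) : s @ \oo --> (0 : R) ->
  t @ \oo --> (0 : R) -> interleave s t @ \oo --> (0 : R).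
Proof.
move=> /cvgrPdist_lt s0 /cvgrPdist_lt t0; apply/cvgrPdist_lt => e e0.
have [N _ Ns] := s0 e e0; have [M _ Mt] := t0 e e0.
exists (maxn N M).*2 => // n /=; rewrite -geq_half_double geq_max.
by move=> /andP[/Ns ? /Mt ?]; rewrite /interleave; case: ifP.
Qed.

(** The supremum over an interleaved sequence is the maximum of the two
    suprema. *)
Lemma gamma_seminorms_directed (q1 q2 : Lip0 x0 F -> R) :
  gamma_seminorms q1 -> gamma_seminorms q2 ->
  exists2 q, gamma_seminorms q & forall f, q1 f <= q f /\ q2 f <= q f.
Proof.
move=> [a1 [x1 [y1 [a1p a10 xy1 ->]]]] [a2 [x2 [y2 [a2p a20 xy2 ->]]]].
pose a := interleave a1 a2; pose x := interleave x1 x2.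
pose y := interleave y1 y2.
have ap n : 0 < a n by rewrite /a /interleave; case: ifP.
have xy n : x n <> y n by rewrite /x /y /interleave; case: ifP.
have a0 : a @ \oo --> (0 : R) by exact: interleave_cvg.
exists (gamma_seminorm a x y); first by exists a, x, y.
move=> f; split; apply: gamma_seminorm_le => // n.
  have := quotient_le_gamma_seminorm ap a0 xy f n.*2.
  by rewrite /a /x /y !interleave_double.
have := quotient_le_gamma_seminorm ap a0 xy f n.*2.+1.
by rewrite /a /x /y !interleave_doubleS.
Qed.

Lemma gamma_seminorms_seminorm (q : Lip0 x0 F -> R) :
  gamma_seminorms q -> seminorm q.
Proof. by move=> [a [x [y [ap a0 xy ->]]]]; exact: gamma_seminorm_seminorm. Qed.

Lemma gamma_seminorms_neq0 : (exists x y : X, x <> y) ->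
  gamma_seminorms (x0 := x0) (F := F) !=set0.
Proof.
move=> [x [y xy]]; exists (gamma_seminorm harmonic (fun=> x) (fun=> y)).
exists harmonic, (fun=> x), (fun=> y); split => //; last exact: cvg_harmonic.
by move=> n; exact: harmonic_gt0.
Qed.

End DifferenceQuotients.

(** * Representation of the continuous functionals *)

Section Main.
Context (R : realType) (k : scalar_kind) (X : metricType R) (x0 : X)
  (F : normedModType (scalars R k)).

(** Here [T f = S (A f)] with [S] bounded on the null sequences, and [phi n] is
    the [n]-th coordinate of [S] multiplied by [alpha n]; the weights are bounded,
    hence the norms remain summable. *)
Lemma dominated_series (T : {scalar Lip0 x0 F}) (alpha : nat -> R)
    (x y : nat -> X) (C : R) :
  (forall n, 0 < alpha n) -> alpha @ \oo --> (0 : R) ->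
  (forall n, x n <> y n) -> 0 < C ->
  (forall f, rnorm (T f) <= C * gamma_seminorm alpha x y f) ->
  exists phi : nat -> {scalar F},
    [/\ forall n, continuous (phi n : F -> scalars R k),
        exists B, forall N, \sum_(0 <= n < N) dual_norm (phi n) <= B &
        forall f,
          series (fun n => phi n (quotient (x n) (y n) f)) @ \oo --> T f].
Proof.
move=> ap a0 xy C0 TC.
pose A : {linear Lip0 x0 F -> c0 F} := weighted_quotients ap a0 xy.
have [||S [SC SA]] := @scalars_hahn_banach R k (Lip0 x0 F) (c0 F)
  (fun u => C * c0_norm u) A T.
- have [cD cZ] := c0_norm_seminorm F; split=> [u w|a u].
    by rewrite -mulrDr ler_pM2l.
  by rewrite cZ mulrCA.
- by move=> f; rewrite -gamma_seminormE.
have philin n : scalar (fun v => S (single n (ofReal k (alpha n) *: v))).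
  move=> a v w; rewrite scalerDr scalerA mulrC -scalerA.
  by rewrite !linearD linearZ/= scalarZ.
pose phi n : {scalar F} := HB.pack
  (fun v => S (single n (ofReal k (alpha n) *: v)))
  (GRing.isLinear.Build _ _ _ _ _ (philin n)).
have rnormZa n (v : F) : rnorm (ofReal k (alpha n) *: v) = alpha n * rnorm v.
  by rewrite rnormZ norm_ofReal rePart_ofReal gtr0_norm.
have phic n : continuous (phi n : F -> scalars R k).
  apply/continuous_scalarP; exists (C * alpha n); split; first exact: mulr_gt0.
  move=> v; rewrite (le_trans (SC _))// -mulrA ler_pM2l//.
  by rewrite -rnormZa; exact: c0_norm_single.
exists phi; split=> //.
  have [M M0 aM] : exists2 M, 0 <= M & forall n, alpha n <= M.
    have /bounded_fun_has_ubound[M aM] : bounded_fun alpha.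
      by apply/cvg_seq_bounded/cvg_ex; exists 0.
    have aM' n : alpha n <= M by apply: aM; exists n.
    by exists M => //; exact: le_trans (ltW (ap 0)) (aM' 0%N).
  exists (C * M) => N; apply: sum_dual_norm_le => // f f1.
  apply: (c0_dual_abs_sum SC (ltW C0) _ M0) => n.
  rewrite rnormZa -[M]mulr1.
  by apply: ler_pM => //; [exact: ltW|exact: rnorm_ge0].
move=> f; rewrite -SA; exact: (c0_dual_sum SC (ltW C0)).
Qed.

(** Each term is at most [|phi n| / alpha n] times the seminorm of [f]. *)
Lemma summable_dominated (T : {scalar Lip0 x0 F}) (phi : nat -> {scalar F})
    (x y : nat -> X) (B : R) :
  (forall n, continuous (phi n : F -> scalars R k)) ->
  (forall n, x n <> y n) ->
  (forall N, \sum_(0 <= n < N) dual_norm (phi n) <= B) ->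
  (forall f, series (fun n => phi n (quotient (x n) (y n) f)) @ \oo --> T f) ->
  exists alpha C, [/\ forall n, 0 < alpha n, alpha @ \oo --> (0 : R), 0 < C &
    forall f, rnorm (T f) <= C * gamma_seminorm alpha x y f].
Proof.
move=> phic xy phiB phiT.
have [alpha [ap a0 [C C0 aC]]] :=
  summable_weights (fun n => dual_norm_ge0 (phic n)) phiB.
exists alpha, C; split=> // f.
apply/ler_addgt0Pr => e e0.
have /(cvg_rnormP _)/(_ e e0)[N _ /(_ N (leqnn N))] := phiT f.
rewrite seriesEnat /=; set s := \sum_(_ <= _ < _) _ => Ts.
rewrite -[T f](subrK s) (le_trans (rnormD _ _))// addrC.
apply: lerD; last exact: ltW.
apply: le_trans (rnorm_sum _ _) _.
apply: (@le_trans _ _ (\sum_(0 <= n < N) dual_norm (phi n) / alpha n *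
    gamma_seminorm alpha x y f)).
  apply: ler_sum => n _.
  rewrite (le_trans (rnorm_le_dual_norm _ (phic n)))// -mulrA ler_wpM2l//.
    exact: dual_norm_ge0.
  by rewrite ler_pdivlMl//; exact: quotient_le_gamma_seminorm.
rewrite -mulr_suml; apply: ler_wpM2r; last exact: aC.
have sg := @gamma_seminorm_seminorm R k X x0 F alpha x y ap a0 xy.
exact: (seminorm_ge0 sg).
Qed.

End Main.

Theorem theorem5p1 (R : realType) (k : scalar_kind) (X : metricType R) (x0 : X)
    (X2 : exists x y : X, x <> y) (F : completeNormedModType (scalars R k))
    (T : {scalar Lip0 x0 F}) :
  continuous (T : Lip0_gamma_tau x0 F -> scalars R k) <->
  exists (phi : nat -> {scalar F}) (x y : nat -> X),
    [/\ forall n, continuous (phi n : F -> scalars R k),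
        forall n, x n <> y n,
        (\sum_(0 <= n <oo) (dual_norm (phi n))%:E < +oo)%E &
        forall f : Lip0 x0 F,
          series (fun n => phi n ((ofReal k (mdist (x n) (y n)))^-1 *:
                                  (f (x n) - f (y n)))) @ \oo --> T f].
Proof.
have dge0 (phi : nat -> {scalar F}) :
    (forall n, continuous (phi n : F -> scalars R k)) ->
    forall n, (0 <= n)%N -> true -> (0 <= (dual_norm (phi n))%:E)%E.
  by move=> phic n _ _; rewrite lee_fin dual_norm_ge0.
apply: (iff_trans (continuous_seminormP
  (@gamma_seminorms_seminorm R k X x0 F) (gamma_seminorms_neq0 x0 F X2)
  (@gamma_seminorms_directed R k X x0 F) T)).
split=> [[_ [C [[alpha [x [y [ap a0 xy ->]]]] C0 TC]]]|].
  have [phi [phic [B phiB] phiT]] := dominated_series ap a0 xy C0 TC.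
  exists phi, x, y; split=> //.
  apply: (@le_lt_trans _ _ B%:E); last exact: ltry.
  apply: lime_le; first exact: is_cvg_nneseries (dge0 phi phic).
  by apply: nearW => N; rewrite sumEFin lee_fin.
move=> [phi [x [y [phic xy phiB phiT]]]].
have [|alpha [C [ap a0 C0 TC]]] := @summable_dominated R k X x0 F T phi x y
   (fine (\sum_(0 <= n <oo) (dual_norm (phi n))%:E)%E) phic xy _ phiT.
  move=> N; rewrite -lee_fin fineK; last first.
    by rewrite ge0_fin_numE ?nneseries_ge0//; exact: dge0.
  by rewrite -sumEFin; apply: nneseries_lim_ge; exact: dge0.
by exists (gamma_seminorm alpha x y), C; split=> //; exists alpha, x, y.
Qed.
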